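(* Let $n\ge 2$ be an integer, let $C_n$ be the cyclic group of order $n$, and let $\rho_1(\mathcal{P}(C_n))$ denote the distance spectral radius of its power graph $\mathcal{P}(C_n)$. Put $l=\phi(n)+1$, where $\phi$ is Euler's totient function. Let $Tr_{avg}$ and $Tr_{max}$ be, respectively, the average and the maximum of the transmissions in $\mathcal{P}(C_n)$ of the elements of $C_n$ that are neither the identity nor a generator of $C_n$ (with $Tr_{avg}=Tr_{max}:=n-1$ if there are no such elements, i.e. if $n$ is prime). Then $$\rho_{1}(\mathcal{P}(C_{n})) \ge \frac{1}{2}\left[ (Tr_{avg}-1) + \sqrt{(Tr_{avg}-2l+1)^{2}+4l(n-l)}\right]$$ and $$\rho_{1}(\mathcal{P}(C_{n}))\le \frac{1}{2}\left[(Tr_{max}-1) + \sqrt{(Tr_{max}-2l+1)^{2}+4l(n-l)}\right].$$ Moreover, equality holds in both bounds if and only if $n=p^{m}$ for some prime number $p$ and some positive integer $m$.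
   Context: The power graph $\mathcal{P}(\mathbb{G})$ of a finite group $\mathbb{G}$ is the simple undirected graph with vertex set $\mathbb{G}$ in which two distinct elements $x,y$ are adjacent if and only if one of them is an integral power of the other; it is always connected. For a connected graph $G$ with vertices $v_1,\dots,v_N$, the distance matrix is $D(G)=(d_{ij})$ with $d_{ij}$ the length of a shortest path between $v_i$ and $v_j$; the distance spectral radius $\rho_1(G)$ is the largest eigenvalue of $D(G)$; the transmission of $v_i$ is $\operatorname{Tr}(v_i)=\sum_{j=1}^N d_{ij}$. *)

(* Defs.v *)
From HB Require Import structures.
From mathcomp Require Import all_boot all_order all_algebra all_fingroup all_solvable.
From mathcomp Require Import boolp classical_sets reals.

Set Implicit Arguments.
Unset Strict Implicit.
Unset Printing Implicit Defensive.

Import Order.TTheory GRing.Theory Num.Theory GroupScope.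

Local Open Scope ring_scope.

Section Graph.
Variables (T : finType) (e : rel T).

(* A shortest path between two connected vertices has length < #|T|; the
   out-of-range value #|T| is returned only for disconnected vertices. *)
Definition gdist (x y : T) : nat :=
  find (fun k => [exists p : k.-tuple T, path e x p && (last x p == y)])
       (iota 0 #|T|).

Lemma gdistP (x y : T) : connect e x y ->
  (exists p, [/\ path e x p, last x p = y & size p = gdist x y]) /\
  (forall p, path e x p -> last x p = y -> (gdist x y <= size p)%N).
Proof.
set P := fun k => [exists p : k.-tuple T, path e x p && (last x p == y)].
have Pi p : path e x p -> last x p = y -> P (size p).
  by move=> ep lp; apply/existsP; exists (in_tuple p); rewrite ep lp eqxx.
case/connectP=> q0 e0 l0; case/shortenP: e0 l0 => q eq uq _ lq.
have qT : (size q < #|T|)%N by rewrite -[X in (X <= _)%N](card_uniqP uq) max_card.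
have hP : has P (iota 0 #|T|).
  by apply/hasP; exists (size q); [rewrite mem_iota | exact: Pi].
have dT : (gdist x y < #|T|)%N by move: hP; rewrite has_find size_iota.
split.
  have := nth_find 0%N hP; rewrite nth_iota // add0n => /existsP[p].
  by case/andP=> ep /eqP lp; exists p; rewrite size_tuple.
move=> p ep lp; rewrite leqNgt; apply/negP => lt_pd.
have := before_find 0%N lt_pd; rewrite nth_iota ?add0n; last exact: ltn_trans dT.
by move: (Pi p ep lp); rewrite /P => ->.
Qed.

Definition transmission (x : T) : nat := \sum_(y : T) gdist x y.

Definition distance_matrix (R : realType) : 'M[R]_#|T| :=
  \matrix_(i, j) (gdist (enum_val i) (enum_val j))%:R.

End Graph.

(* The largest element of the spectrum (which exists when A is symmetric of
   positive size); 0 if there is none. *)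
Definition largest_eigenvalue (R : realType) (m : nat) (A : 'M[R]_m) : R :=
  xget 0 [set a : R | eigenvalue A a /\ forall b, eigenvalue A b -> b <= a]%classic.

Definition distance_spectral_radius (R : realType) (T : finType) (e : rel T) : R :=
  largest_eigenvalue (distance_matrix e R).

Section PowerGraph.
Variable gT : finGroupType.

(* The cyclic subgroup <[y]> is the set of integral powers of y. *)
Definition power_graph : rel gT :=
  [rel x y | (x != y) && ((x \in <[y]>) || (y \in <[x]>))].

Lemma power_graphP (x y : gT) :
  reflect (x <> y /\ ((exists k : nat, x = (y ^+ k)%g) \/
                      (exists k : nat, y = (x ^+ k)%g)))
          (power_graph x y).
Proof.
apply: (iffP andP) => -[/eqP xy H]; split=> //.
  by case/orP: H => /cycleP[k ->]; [left | right]; exists k.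
by apply/orP; case: H => -[k ->]; [left | right]; exact: mem_cycle.
Qed.

Definition nontrivial_nongenerators : {set gT} :=
  [set x | (x != 1%g) && ~~ generator [set: gT] x].

Definition tr_avg (R : realType) : R :=
  let S := nontrivial_nongenerators in
  if #|S| == 0%N then #|gT|%:R - 1
  else (\sum_(x in S) (transmission power_graph x)%:R) / #|S|%:R.

Definition tr_max : nat :=
  let S := nontrivial_nongenerators in
  if #|S| == 0%N then #|gT|.-1
  else \max_(x in S) transmission power_graph x.

End PowerGraph.

Arguments distance_spectral_radius R {T} e.
Arguments power_graph gT : clear implicits.
Arguments tr_avg gT R : clear implicits.
Arguments tr_max gT : clear implicits.

(* Main.v *)
Require Import Defs.
From HB Require Import structures.
From mathcomp Require Import all_boot all_order all_algebra all_fingroup all_solvable.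
From mathcomp Require Import reals.
From mathcomp Require Import complex spectral sesquilinear ring lra.
From mathcomp Require classical_sets.

(** The power graph of a cyclic group has diameter at most 2 and the identity
    and the generators are adjacent to everything.  Write L for these l
    dominating elements, S for the others, D for the distance matrix and Tr for
    the transmission.  A vector equal to a on L and to b on S is mapped by D to
      (l - 1) a + |S| b  on L   and   l a + (Tr x - l) b  at x in S.
    Replacing Tr x by a number t gives the 2 x 2 quotient matrix
      [l - 1, |S| ; l, t - l],
    whose largest eigenvalue lambda is the value of the bound at t and whose
    eigenvector is (lambda - t + l, l), with positive entries.  The
    corresponding vector v thus satisfies
      D v = lambda v + l (Tr - t) 1_S            ([kernel_op_two_block]).

    If t is the average of Tr over S, the error term is orthogonal to v, the
    Rayleigh quotient of v is lambda, and so lambda <= rho.  If t is the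
    maximum, then D v <= lambda v entrywise, and pairing with a positive
    eigenvector of rho gives rho <= lambda.  In both cases equality forces
    D v = lambda v, that is, Tr = t on all of S, and conversely
    ([two_block_lower], [two_block_upper]).

    It remains to see when Tr is constant on S.  If the order of the group is a
    prime power, its subgroups form a chain and the power graph is complete.
    Otherwise two distinct primes p and q divide the order n.  An element of
    order p is nonadjacent exactly to the nontrivial elements of the Hall
    p'-subgroup, so its transmission is (n - 1) + (n_p' - 1), where n_p' is the
    part of n prime to p; and n_p' differs from n_q' because only the latter is
    divisible by p ([constant_transmission_prime_power]).

    The spectral input is the existence of a largest eigenvalue of a real
    symmetric matrix and its Rayleigh characterisation with the equality case
    ([rayleigh_max]), from which a positive eigenvector is obtained by taking
    absolute values ([perron_vector]). *)

Set Implicit Arguments.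
Unset Strict Implicit.
Unset Printing Implicit Defensive.

Import Order.TTheory GRing.Theory Num.Theory.

Local Open Scope ring_scope.

(** * Rayleigh quotients of real symmetric matrices *)

Section Rayleigh.
Import Num.Def.
Local Open Scope sesquilinear_scope.
Variables (R : rcfType) (m : nat) (A : 'M[R]_m).
Hypotheses (m_gt0 : (0 < m)%N) (A_sym : A^T = A).

(** Over the complex extension of [R] the matrix is unitarily diagonalisable
    with real eigenvalues r i.  In the coordinates w of u in the eigenbasis,
    a * |u|^2 - u A u^T is the sum of the (a - r i) * |w i|^2, where a is the
    largest r i; the terms are nonnegative, and they all vanish exactly when u
    is in the eigenspace of a. *)
Lemma rayleigh_max :
  exists2 a, eigenvalue A a &
    forall u : 'rV_m, (u *m A *m u^T) 0 0 <= a * (u *m u^T) 0 0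
                        ?= iff (u *m A == a *: u).
Proof.
pose f : {rmorphism R -> R[i]} := real_complex R; pose AC := map_mx f A.
have f_real (x : R) : f x \is Num.real by apply/complex_realP; exists x.
have realC (k n : nat) (B : 'M[R]_(k, n)) : map_mx f B ^ conjC = map_mx f B.
  by apply/matrixP => i j; rewrite !mxE; apply/CrealP.
have AC_herm : AC \is hermsymmx.
  apply: realsym_hermsym.
    apply/is_hermitianmxP; rewrite expr0 scale1r map_mx_id //.
    by rewrite /AC -{1}A_sym map_trmx.
  by apply/mxOverP => i j; rewrite mxE.
set P := spectralmx AC; set d := spectral_diag AC.
have P_unit : P \is unitarymx := spectral_unitarymx AC.
have defAC : AC = P^t* *m diag_mx d *m P.
  by rewrite -invmx_unitary //; apply/orthomx_spectralP/hermitian_normalmx.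
(* The spectrum of a Hermitian matrix is real, so it can be ordered in [R]. *)
pose r i := complex.Re (d 0 i).
have dE i : d 0 i = f (r i).
  apply/esym/RRe_real; exact: mxOverP (hermitian_spectral_diag_real AC_herm) _ _.
pose i0 : 'I_m := Ordinal m_gt0.
have [k _ r_max] := @arg_maxP _ _ _ i0 xpredT r isT.
exists (r k).
  rewrite -(eigenvalue_map f); apply/eigenvalueP; exists (row k P).
    rewrite -/AC defAC -row_mul !mulmxA (unitarymxP P_unit) mul1mx.
    apply/rowP => j; rewrite !mxE (bigD1 k) //= big1 ?addr0 => [|i /negPf ik].
      by rewrite !mxE eqxx mulr1n dE.
    by rewrite !mxE eq_sym ik mulr0n mul0r.
  apply: contraTneq P_unit => rowk0; apply/unitarymxP => /row_matrixP/(_ k).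
  rewrite row_mul rowk0 mul0mx row1 => /rowP/(_ k)/eqP.
  by rewrite !mxE !eqxx eq_sym oner_eq0.
move=> u; have [w defu] : exists w, map_mx f u = w *m P.
  by exists (map_mx f u *m P^t*); rewrite mulmxKtV.
have uA : map_mx f (u *m A) = w *m diag_mx d *m P.
  by rewrite map_mxM -/AC defAC defu !mulmxA mulmxtVK.
have uT : map_mx f u^T = P^t* *m w^t*.
  by rewrite -map_mxM -trmx_mul -defu map_trmx realC.
have qf (B : 'M[R]_(1, m)) (x : 'rV[R[i]]_m) : map_mx f B = x *m P ->
    f ((B *m u^T) 0 0) = \sum_i x 0 i * (w 0 i)^*.
  move=> defB; have -> : f ((B *m u^T) 0 0) = map_mx f (B *m u^T) 0 0.
    by rewrite [RHS]mxE.
  rewrite map_mxM defB uT mulmxA mulmxtVK // mxE.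
  by apply: eq_bigr => i _; rewrite !mxE.
have gap : f (r k * (u *m u^T) 0 0 - (u *m A *m u^T) 0 0) =
    \sum_i f (r k - r i) * `|w 0 i| ^+ 2.
  rewrite rmorphB rmorphM (qf _ _ defu) (qf _ _ uA) mulr_sumr -sumrB.
  apply: eq_bigr => i _; rewrite normCK mul_mx_diag mxE. rewrite dE rmorphB.
  by rewrite mulrBl !mulrA [_ * f (r i)]mulrC.
have gap_ge0 i : 0 <= f (r k - r i) * `|w 0 i| ^+ 2.
  by rewrite mulr_ge0 ?exprn_ge0 // ler0c subr_ge0; exact: r_max.
split; first by rewrite -subr_ge0 -ler0c -/(f _) gap sumr_ge0.
apply/eqP/eqP => [eq_uA | ->]; last by rewrite -scalemxAl mxE.
have sum0 : \sum_i f (r k - r i) * `|w 0 i| ^+ 2 = 0.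
  by rewrite -gap eq_uA subrr rmorph0.
apply: (@map_mx_inj _ _ f).
rewrite uA map_mxZ defu [RHS]scalemxAl; congr (_ *m P).
apply/rowP => i; rewrite mul_mx_diag !mxE dE mulrC.
have /(_ i isT) /eqP := psumr_eq0P (fun i _ => gap_ge0 i) sum0.
rewrite mulf_eq0 sqrf_eq0 normr_eq0 fmorph_eq0 subr_eq0.
by case/orP=> [/eqP<- // | /eqP->]; rewrite !mulr0.
Qed.
End Rayleigh.

Lemma largest_eigenvalueP (R : realType) (m : nat) (A : 'M[R]_m) :
  (0 < m)%N -> A^T = A ->
  eigenvalue A (largest_eigenvalue A) /\
  forall u : 'rV_m, (u *m A *m u^T) 0 0 <= largest_eigenvalue A * (u *m u^T) 0 0
                      ?= iff (u *m A == largest_eigenvalue A *: u).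
Proof.
move=> m_gt0 A_sym; have [a eig_a ray_a] := rayleigh_max m_gt0 A_sym.
suff -> : largest_eigenvalue A = a by [].
have dot_gt0 (u : 'rV[R]_m) : u != 0 -> 0 < (u *m u^T) 0 0.
  move=> u0; have ge0 i : true -> 0 <= u 0 i * u^T i 0.
    by rewrite mxE -expr2 sqr_ge0.
  rewrite mxE lt_neqAle sumr_ge0 // andbT eq_sym psumr_neq0 //.
  case/rV0Pn: u0 => i ui0; apply/hasP; exists i; rewrite ?mem_index_enum //=.
  by rewrite mxE -expr2 exprn_even_gt0.
have max_a b : eigenvalue A b -> b <= a.
  case/eigenvalueP => u uA u0; have [+ _] := ray_a u.
  have -> : (u *m A *m u^T) 0 0 = b * (u *m u^T) 0 0.
    by rewrite uA -scalemxAl [LHS]mxE.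
  by rewrite ler_pM2r ?dot_gt0.
apply: classical_sets.xget_unique; first by split.
by move=> b [eig_b max_b]; apply/eqP; rewrite eq_le max_a // max_b.
Qed.

(** * Positive eigenvectors of symmetric kernels *)

Section SymmetricKernel.
Variables (R : realFieldType) (T : finType) (d : T -> T -> R).

(** A matrix indexed by [T] is handled as a kernel acting on functions, so that
    vertices need not be numbered. *)
Definition kernel_op (f : T -> R) (x : T) : R := \sum_y d x y * f y.

Definition dot (f g : T -> R) : R := \sum_x f x * g x.

(** The second clause is the Rayleigh bound together with its equality case;
    with the first it characterises the largest eigenvalue. *)
Definition top_eigenvalue (rho : R) : Prop :=
  (exists2 f, exists x, f x != 0 & forall x, kernel_op f x = rho * f x) /\
  (forall f, dot (kernel_op f) f <= rho * dot f f
               ?= iff [forall x, kernel_op f x == rho * f x]).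

Hypothesis d_sym : forall x y, d x y = d y x.

Lemma dot_kernel_op f g : dot (kernel_op f) g = dot f (kernel_op g).
Proof.
rewrite /dot /kernel_op; under eq_bigr do rewrite mulr_suml.
rewrite exchange_big; apply: eq_bigr => y _; rewrite mulr_sumr.
by apply: eq_bigr => x _; rewrite d_sym mulrAC mulrC.
Qed.

Lemma dot_eq_pos v f g : (forall x, 0 < v x) -> (forall x, f x <= g x) ->
  dot v f = dot v g -> forall x, f x = g x.
Proof.
move=> v_gt0 le_fg /eqP; rewrite eq_sym -subr_eq0 -sumrB.
rewrite psumr_eq0 => [/allP eq0 x|x _]; last first.
  by rewrite -mulrBr mulr_ge0 ?subr_ge0 // ltW.
have := eq0 x (mem_index_enum _); rewrite /= -mulrBr mulf_eq0 gt_eqF //= subr_eq0.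
by move/eqP.
Qed.

Lemma dot_gt0 f : (exists x, f x != 0) -> 0 < dot f f.
Proof.
case=> x fx0; rewrite /dot (bigD1 x) //= ltr_pwDl //.
  by rewrite -expr2 exprn_even_gt0.
by apply: sumr_ge0 => y _; rewrite -expr2 sqr_ge0.
Qed.

Variable rho : R.
Hypothesis rhoP : top_eigenvalue rho.

Section Positive.
Hypotheses (d_ge0 : forall x y, 0 <= d x y)
           (d_gt0 : forall x y, x != y -> 0 < d x y).

(** The absolute value g of an eigenvector f of rho has the same norm as f and
    a Rayleigh quotient at least as large, so g attains the maximum and is again
    an eigenvector.  If g vanished at x, the equation at x would make the sum of
    the nonnegative d x y * g y zero, hence g = 0. *)
Lemma perron_vector :
  exists2 g, forall x, 0 < g x & forall x, kernel_op g x = rho * g x.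
Proof.
have [[f [z fz] eig_f] ray] := rhoP; pose g x := `|f x|.
have eq_dot : dot g g = dot f f.
  by apply: eq_bigr => x _; rewrite -normrM ger0_norm // -expr2 sqr_ge0.
have le_dot : rho * dot g g <= dot (kernel_op g) g.
  rewrite eq_dot mulr_sumr; apply: ler_sum => x _; rewrite mulrA -eig_f.
  rewrite (le_trans (ler_norm _)) // normrM ler_wpM2r //.
  rewrite (le_trans (ler_norm_sum _ _ _)) // ler_sum // => y _.
  by rewrite normrM ger0_norm.
have eig_g x : kernel_op g x = rho * g x.
  by move: le_dot; rewrite (ge_leif (ray g)) => /forallP/(_ x)/eqP.
exists g => // x; rewrite lt_neqAle normr_ge0 andbT eq_sym.
apply: contraNneq fz => gx0; have /eqP := eig_g x.
rewrite gx0 mulr0 psumr_eq0 => [/allP eq0|y _]; last first.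
  exact: mulr_ge0 (d_ge0 _ _) (normr_ge0 _).
have [->|zx] := eqVneq z x; first by rewrite -normr_eq0; apply/eqP.
have := eq0 z (mem_index_enum _).
by rewrite /= mulf_eq0 normr_eq0 gt_eqF // d_gt0 // eq_sym.
Qed.

(** Collatz-Wielandt bound: pair the inequality with a positive eigenvector g of
    rho and use that the kernel is symmetric.  Since all entries of g are
    positive, equality in the sum is equality in each entry. *)
Lemma top_eigenvalue_le v lambda : T -> (forall x, 0 < v x) ->
  (forall x, kernel_op v x <= lambda * v x) ->
  rho <= lambda ?= iff [forall x, kernel_op v x == lambda * v x].
Proof.
move=> x0 v_gt0 le_v; have [g g_gt0 eig_g] := perron_vector.
have gv_gt0 : 0 < dot g v.
  rewrite /dot (bigD1 x0) //= ltr_pwDl ?mulr_gt0 // sumr_ge0 // => y _.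
  by rewrite ltW ?mulr_gt0.
have dotr : dot g (kernel_op v) = rho * dot g v.
  rewrite -dot_kernel_op mulr_sumr.
  by apply: eq_bigr => x _; rewrite eig_g mulrA.
have dotl : dot g (fun x => lambda * v x) = lambda * dot g v.
  by rewrite mulr_sumr; apply: eq_bigr => x _; rewrite mulrCA.
split.
  rewrite -(ler_pM2r gv_gt0) -dotr -dotl; apply: ler_sum => x _.
  by rewrite ler_wpM2l // ltW.
apply/eqP/forallP => [eq_rho x | eq_v].
  by apply/eqP; apply: (dot_eq_pos g_gt0 le_v); rewrite dotr dotl eq_rho.
apply: (mulIf (lt0r_neq0 gv_gt0)); rewrite -dotr -dotl.
by apply: eq_bigr => x _; rewrite (eqP (eq_v x)).
Qed.

(** A test vector with Rayleigh quotient lambda.  Positivity of v is what makes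
    the equality case an equivalence: a positive eigenvector belongs to rho, by
    [top_eigenvalue_le]. *)
Lemma top_eigenvalue_ge v lambda : T -> (forall x, 0 < v x) ->
  dot (kernel_op v) v = lambda * dot v v ->
  lambda <= rho ?= iff [forall x, kernel_op v x == lambda * v x].
Proof.
move=> x0 v_gt0 dot_v.
have vv_gt0 : 0 < dot v v by apply: dot_gt0; exists x0; rewrite gt_eqF.
have := rhoP.2 v; rewrite dot_v => -[le_v eq_v]; split.
  by rewrite -(ler_pM2r vv_gt0).
apply/eqP/forallP => [eq_rho x | eig_v].
  by move: eq_v; rewrite eq_rho eqxx => /esym/forallP.
have [le_rho _] : rho <= lambda ?= iff [forall x, kernel_op v x == lambda * v x].
  by apply: top_eigenvalue_le => // x; rewrite (eqP (eig_v x)).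
by apply/le_anti; rewrite le_rho -(ler_pM2r vv_gt0) le_v.
Qed.
End Positive.
End SymmetricKernel.

(** Transports [largest_eigenvalueP] from row vectors indexed by ordinals to
    functions on the vertices. *)
Lemma distance_spectral_radiusP (R : realType) (T : finType) (e : rel T) :
  T -> (forall x y, gdist e x y = gdist e y x) ->
  top_eigenvalue (fun x y => (gdist e x y)%:R) (distance_spectral_radius R e).
Proof.
move=> x0 d_sym; set d := fun x y => _.
have T_gt0 : (0 < #|T|)%N by apply/card_gt0P; exists x0.
have D_sym : (distance_matrix e R)^T = distance_matrix e R.
  by apply/matrixP => i j; rewrite !mxE d_sym.
have sumT (F : T -> R) : \sum_(i < #|T|) F (enum_val i) = \sum_x F x.
  by rewrite [RHS](reindex _ (onW_bij _ (enum_val_bij T))).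
have mulD (u : 'rV[R]_#|T|) f : (forall i, u 0 i = f (enum_val i)) ->
    forall i, (u *m distance_matrix e R) 0 i = kernel_op d f (enum_val i).
  move=> uf i; rewrite mxE /kernel_op -sumT; apply: eq_bigr => j _.
  by rewrite mxE uf mulrC /d d_sym.
have [eig ray] := largest_eigenvalueP T_gt0 D_sym.
rewrite /distance_spectral_radius; set rho := largest_eigenvalue _ in eig ray *.
split.
  case/eigenvalueP: eig => u uD /rV0Pn[i ui0].
  exists (fun x => u 0 (enum_rank x)); first by exists (enum_val i); rewrite enum_valK.
  move=> x; rewrite -{1}(enum_rankK x) -(mulD u) ?uD ?mxE // => j.
  by rewrite enum_valK.
move=> f; pose u : 'rV[R]_#|T| := \row_i f (enum_val i).
have uf i : u 0 i = f (enum_val i) by rewrite mxE.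
have -> : dot (kernel_op d f) f = (u *m distance_matrix e R *m u^T) 0 0.
  rewrite [RHS]mxE /dot -sumT; apply: eq_bigr => i _.
  by rewrite (mulD _ _ uf) [u^T _ _]mxE uf.
have -> : dot f f = (u *m u^T) 0 0.
  by rewrite [RHS]mxE /dot -sumT; apply: eq_bigr => i _; rewrite [u^T _ _]mxE uf.
have -> // : [forall x, kernel_op d f x == rho * f x] = (u *m distance_matrix e R == rho *: u).
apply/forallP/eqP => [eig_f | eig_u x].
  by apply/rowP => i; rewrite (mulD _ _ uf) (eqP (eig_f _)) [RHS]mxE uf.
by rewrite -(enum_rankK x) -(mulD _ _ uf) eig_u mxE uf.
Qed.

(** * Graphs with dominating vertices *)

(** A walk through the dominating vertex z has length at most 2. *)
Lemma gdist_dominated (T : finType) (e : rel T) (z : T) :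
  symmetric e -> (forall y, y != z -> e z y) ->
  forall x y, gdist e x y = if x == y then 0%N else if e x y then 1%N else 2%N.
Proof.
move=> e_sym e_z x y.
have xz : connect e x z.
  have [->|xz] := eqVneq x z; first exact: connect0.
  by rewrite connect1 // e_sym e_z.
have zy : connect e z y.
  have [->|yz] := eqVneq y z; first exact: connect0.
  by rewrite connect1 // e_z.
have [[p [ep lp <-]] dmin] := gdistP (connect_trans xz zy).
have [eq_xy|xy] := eqVneq x y.
  by apply/eqP; rewrite -leqn0 -[0%N]/(size (@nil T)) (dmin [::]).
have p_gt0 : (0 < size p)%N by case: p lp {ep dmin} => //= /eqP; rewrite (negPf xy).
case: ifP => exy.
  by apply/eqP; rewrite eqn_leq p_gt0 andbT (dmin [:: y]) //= exy.
have p_gt1 : (1 < size p)%N.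
  case: p ep lp p_gt0 {dmin} => [//|u [|//]] /=; rewrite andbT => exu eq_uy.
  by rewrite -eq_uy exu in exy.
apply/eqP; rewrite eqn_leq p_gt1 andbT (dmin [:: z; y]) //= andbT.
have xz' : x != z.
  apply: contraFneq exy => eq_xz; move: xy; rewrite eq_xz eq_sym.
  exact: e_z.
have yz' : y != z by apply: contraFneq exy => ->; rewrite e_sym e_z.
by rewrite e_sym !e_z.
Qed.

(** The setting of this section is a distance-like kernel for which every vertex
    outside S is at distance 1 from all the others. *)
Section TwoBlocks.
Variables (R : rcfType) (T : finType) (d : T -> T -> R) (S : {set T}) (rho t : R).

Hypotheses (d_sym : forall x y, d x y = d y x)
           (d_ge0 : forall x y, 0 <= d x y)
           (d_gt0 : forall x y, x != y -> 0 < d x y)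
           (d_diag : forall x, d x x = 0)
           (d_one : forall x y, x \notin S -> x != y -> d x y = 1).
Hypothesis rhoP : top_eigenvalue d rho.

Let l : R := #|~: S|%:R.
Let tr x := \sum_y d x y.

(** The larger root of the characteristic polynomial of the quotient matrix
    [l - 1, |S| ; l, t - l]. *)
Definition two_block_eigenvalue : R :=
  1 / 2 * ((t - 1) + Num.sqrt ((t - 2 * l + 1) ^+ 2 + 4 * l * (#|T|%:R - l))).

Let lambda := two_block_eigenvalue.
Let a := lambda - t + l.

(** Of the two proportional forms of the eigenvector of the quotient matrix, the
    one that stays nonzero when S is empty. *)
Definition two_block_vector (x : T) : R := if x \in S then l else a.

Let cardS : #|T|%:R - l = #|S|%:R.
Proof. by rewrite /l -(cardsC S) natrD addrK. Qed.

Let disc_ge0 : 0 <= (t - 2 * l + 1) ^+ 2 + 4 * l * #|S|%:R.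
Proof. by rewrite addr_ge0 ?sqr_ge0 // !mulr_ge0. Qed.

Lemma two_block_eigenvalueE :
  (lambda - (l - 1)) * (lambda - (t - l)) = l * #|S|%:R.
Proof.
rewrite /lambda /two_block_eigenvalue cardS; set q := Num.sqrt _.
have : q ^+ 2 = (t - 2 * l + 1) ^+ 2 + 4 * l * #|S|%:R by rewrite sqr_sqrtr.
move=> q2; have : q ^+ 2 - (t - 2 * l + 1) ^+ 2 = 4 * (l * #|S|%:R) by rewrite q2; ring.
move=> q3; apply: (@mulfI _ 4); first by rewrite pnatr_eq0.
by rewrite -q3; field.
Qed.

Hypothesis S_neqT : S != [set: T].

Let l_gt0 : 0 < l.
Proof.
rewrite /l ltr0n card_gt0; apply: contraNneq S_neqT => SC0.
by rewrite -[S]setCK SC0 setC0.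
Qed.

(* When S is empty the discriminant is a square, and the entry on the complement
   of S is positive only for t in this range. *)
Hypothesis t_small : S = set0 -> t < 2 * l - 1.

Lemma two_block_vector_gt0 x : 0 < two_block_vector x.
Proof.
rewrite /two_block_vector; case: ifP => // _.
rewrite /a /lambda /two_block_eigenvalue cardS; set q := Num.sqrt _.
suff : t - 2 * l + 1 < q by lra.
have [S0|S_neq0] := eqVneq S set0.
  by rewrite (@lt_le_trans _ _ 0) ?sqrtr_ge0 //; have := t_small S0; lra.
rewrite (le_lt_trans (ler_norm _)) // -sqrtr_sqr ltr_sqrt; last first.
  by rewrite ltr_wpDl ?sqr_ge0 // !mulr_gt0 // ltr0n card_gt0.
by rewrite ltrDl !mulr_gt0 // ltr0n card_gt0.
Qed.

(** The quotient equations hold exactly outside S; at x in S, the row sum tr x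
    replaces the value t for which they were solved. *)
Lemma kernel_op_two_block x :
  kernel_op d two_block_vector x =
    lambda * two_block_vector x + (if x \in S then l * (tr x - t) else 0).
Proof.
have sumL (c : R) : \sum_(y | y \notin S) c = c * l.
  rewrite sumr_const /l mulr_natr; congr (_ *+ _).
  by apply: eq_card => y; rewrite inE.
have sumS (c : R) : \sum_(y in S) c = c * #|S|%:R.
  by rewrite sumr_const mulr_natr.
rewrite /kernel_op (bigID (fun y => y \in S)) /=.
have -> : \sum_(y in S) d x y * two_block_vector y = l * \sum_(y in S) d x y.
  by rewrite mulr_sumr; apply: eq_bigr => y yS; rewrite /two_block_vector yS mulrC.
have -> : \sum_(y | y \notin S) d x y * two_block_vector y
          = a * \sum_(y | y \notin S) d x y.
  rewrite mulr_sumr; apply: eq_bigr => y yS.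
  by rewrite /two_block_vector (negPf yS) mulrC.
rewrite /two_block_vector; case: ifPn => xS.
  have trL : \sum_(y | y \notin S) d x y = l.
    rewrite (eq_bigr (fun=> 1)) ?sumL ?mul1r // => y yS.
    by rewrite d_sym d_one //; apply: contraNneq yS => ->.
  have -> : \sum_(y in S) d x y = tr x - l.
    by rewrite [tr x](bigID (fun y => y \in S)) /= trL addrK.
  by rewrite trL /a; ring.
have -> : \sum_(y in S) d x y = #|S|%:R.
  rewrite (eq_bigr (fun=> 1)) ?sumS ?mul1r // => y yS.
  by rewrite d_one //; apply: contraNneq xS => ->.
have -> : \sum_(y | y \notin S) d x y = l - 1.
  rewrite -[l]mul1r -sumL (bigD1 x) //= [in RHS](bigD1 x) //= d_diag.
  rewrite add0r addrC addrK; apply: eq_bigr => y /andP[_ yx].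
  by rewrite d_one // eq_sym.
by rewrite -two_block_eigenvalueE /a; ring.
Qed.

Let eq_const :
  [forall x, kernel_op d two_block_vector x == lambda * two_block_vector x]
  = [forall x in S, tr x == t].
Proof.
apply: eq_forallb => x; rewrite kernel_op_two_block -subr_eq0 addrC addKr.
case: (x \in S); last by rewrite eqxx.
by rewrite mulf_eq0 gt_eqF //= subr_eq0.
Qed.

Let x0 : T.
Proof. by case: (pickP (mem (~: S))) l_gt0 => // /eq_card0; rewrite /l => ->; rewrite ltxx. Qed.

Lemma two_block_upper : (forall x, x \in S -> tr x <= t) ->
  rho <= lambda ?= iff [forall x in S, tr x == t].
Proof.
move=> tr_le; rewrite -eq_const.
apply: top_eigenvalue_le => //; first exact: two_block_vector_gt0.
move=> x; rewrite kernel_op_two_block gerDl; case: ifP => // xS.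
by rewrite pmulr_rle0 // subr_le0 tr_le.
Qed.

Lemma two_block_lower : \sum_(x in S) tr x = t * #|S|%:R ->
  lambda <= rho ?= iff [forall x in S, tr x == t].
Proof.
move=> tr_avg; rewrite -eq_const.
apply: top_eigenvalue_ge => //; first exact: two_block_vector_gt0.
rewrite /dot; under eq_bigr do rewrite kernel_op_two_block mulrDl.
rewrite big_split /= [X in _ + X](_ : _ = 0) ?addr0.
  by rewrite mulr_sumr; apply: eq_bigr => x _; rewrite mulrA.
rewrite (bigID (fun y => y \in S)) /= [X in _ + X]big1 ?addr0; last first.
  by move=> x /negPf->; rewrite mul0r.
rewrite (eq_bigr (fun x => l * l * (tr x - t))) => [|x xS]; last first.
  by rewrite /two_block_vector xS; ring.
by rewrite -mulr_sumr sumrB tr_avg sumr_const mulr_natr subrr mulr0.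
Qed.
End TwoBlocks.

(** * Transmissions in the power graph of a cyclic group *)

Section CyclicPowerGraph.
Local Open Scope group_scope.
Variable gT : finGroupType.
Hypothesis gT_cyclic : cyclic [set: gT].

Lemma power_graph_sym : symmetric (power_graph gT).
Proof. by move=> x y; rewrite /power_graph /= eq_sym orbC. Qed.

Lemma power_graph1 (y : gT) : y != 1 -> power_graph gT 1 y.
Proof. by move=> y1; rewrite /power_graph /= eq_sym y1 group1. Qed.

Lemma gdist_power_graph (x y : gT) :
  gdist (power_graph gT) x y =
    if x == y then 0%N else if power_graph gT x y then 1%N else 2%N.
Proof. by rewrite (gdist_dominated power_graph_sym power_graph1). Qed.

(** A cyclic group has at most one subgroup of each order, so adjacency in the
    power graph is comparability of the orders under divisibility. *)
Lemma mem_cycle_dvdn (x y : gT) : (x \in <[y]>) = (#[x] %| #[y])%N.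
Proof. by rewrite -cycle_subG /order (cardSg_cyclic gT_cyclic) ?subsetT. Qed.

Lemma power_graph_dominating (x y : gT) :
  x \notin nontrivial_nongenerators gT -> x != y -> power_graph gT x y.
Proof.
rewrite inE negb_and !negbK /power_graph /= => + xy; rewrite xy => /orP[/eqP-> | /eqP genx].
  by rewrite group1.
by rewrite -genx in_setT orbT.
Qed.

Lemma card_dominating : (1 < #|gT|)%N ->
  #|~: nontrivial_nongenerators gT| = (totient #|gT|).+1.
Proof.
move=> gT_gt1; have /cyclicP[a defT] := gT_cyclic.
have -> : ~: nontrivial_nongenerators gT = 1 |: [set x | generator <[a]> x].
  by apply/setP => x; rewrite !inE negb_and !negbK defT.
rewrite cardsU1 -totient_gen /order -defT cardsT inE /generator.
case: eqP => // /(congr1 (fun A : {set gT} => #|A|)) /eqP.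
by rewrite cardsT cycle1 cards1 gtn_eqF.
Qed.

(** Orders of elements are powers of p, hence pairwise comparable under
    divisibility: the graph is complete. *)
Lemma transmission_prime_power (p m : nat) (x : gT) : prime p ->
  #|gT| = (p ^ m)%N -> transmission (power_graph gT) x = #|gT|.-1.
Proof.
move=> p_pr cardT; have ord_p (y : gT) : {k | #[y] = (p ^ k)%N}.
  apply: p_natP; apply: (@mem_p_elt _ _ _ [set: gT]); last exact: in_setT.
  by rewrite /pgroup cardsT cardT pnatX pnat_id.
rewrite /transmission (bigD1 x) //= gdist_power_graph eqxx add0n.
rewrite (eq_bigr (fun=> 1%N)) => [|y yx].
  by rewrite sum1_card cardC1.
rewrite gdist_power_graph eq_sym (negPf yx) /power_graph /= eq_sym yx !mem_cycle_dvdn.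
have [[j ->] [k ->]] := (ord_p x, ord_p y).
by case: (leqP j k) => [le | /ltnW le]; rewrite (dvdn_exp2l p le) ?orbT.
Qed.

(** Each of the other elements contributes 1, plus 1 more if it is nonadjacent to
    x.  As x has prime order p, the nonadjacent elements are the nontrivial ones
    of order prime to p, which with the identity make up the Hall p'-subgroup. *)
Lemma transmission_prime_order (p : nat) (x : gT) : prime p -> #[x] = p ->
  transmission (power_graph gT) x = (#|gT|.-1 + (#|gT|`_p^').-1)%N.
Proof.
move=> p_pr ox; pose K := 'O_p^'([set: gT])%G.
have K_hall : p^'.-Hall([set: gT]) K.
  by rewrite nilpotent_pcore_Hall ?abelian_nil ?cyclic_abelian.
have memK y : (y \in K) = ~~ (p %| #[y])%N.
  by rewrite (mem_normal_Hall K_hall (pcore_normal _ _)) ?in_setT // -p'natE.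
have cardK : #|K| = (#|gT|`_p^')%N by rewrite (card_Hall K_hall) cardsT.
have distE y : gdist (power_graph gT) x y = ((y != x) + (y \in K :\ 1%g))%N.
  rewrite gdist_power_graph /power_graph /= [x == y]eq_sym 2!inE memK !mem_cycle_dvdn ox.
  have [->|yx] := eqVneq y x; first by rewrite ox dvdnn andbF.
  have [->|y1] := eqVneq y 1; first by rewrite order1 dvd1n orbT.
  case: (boolP (p %| #[y])%N) => //= pNy.
  have -> // : (#[y] %| p)%N = false.
  apply/negP; case/primeP: p_pr => _ dvp /dvp; rewrite order_eq1 (negPf y1) /=.
  by move/eqP=> oy; rewrite oy dvdnn in pNy.
rewrite /transmission (eq_bigr _ (fun y _ => distE y)) big_split /=.
congr (_ + _)%N.
  by rewrite -big_mkcond sum1_card cardC1.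
by rewrite -big_mkcond sum1_card -cardK (cardsD1 1 K) group1.
Qed.

(** If two distinct primes p and q divide the order, elements of these orders are
    not generators, and by [transmission_prime_order] equality of their
    transmissions would equate the p'-part and the q'-part of the order,
    although p divides only the second. *)
Lemma constant_transmission_prime_power : (1 < #|gT|)%N ->
  {in nontrivial_nongenerators gT &, forall x y,
     transmission (power_graph gT) x = transmission (power_graph gT) y} ->
  exists p m : nat, [/\ prime p, (0 < m)%N & #|gT| = (p ^ m)%N].
Proof.
move=> gT_gt1 tr_const; have [p p_pr p_dv] := pdivP gT_gt1.
have [/p_natP[m cardT] | ] := boolP (p.-nat #|gT|).
  by exists p, m; split=> //; case: m cardT gT_gt1 => // ->.
have gT_gt0 : (0 < #|gT|)%N by exact: ltnW.
move=> pN; have [q [q_pr q_dv qp]] : exists q, [/\ prime q, (q %| #|gT|)%N & q != p].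
  case: (pickP [pred q : 'I_#|gT|.+1 | [&& prime q, (q %| #|gT|)%N & val q != p]]).
    by move=> q /and3P[*]; exists q.
  move=> noq; case/pnatP: pN => // q q_pr q_dv.
  have q_lt : (q < #|gT|.+1)%N by rewrite ltnS dvdn_leq.
  by have /= := noq (Ordinal q_lt); rewrite q_pr q_dv /= => /negbFE.
have elt_of r s : prime r -> prime s -> r != s -> (r %| #|gT|)%N -> (s %| #|gT|)%N ->
    exists2 x, x \in nontrivial_nongenerators gT & #[x] = r.
  move=> r_pr s_pr rs r_dv s_dv.
  have [|x _ ox] := @Cauchy _ r [set: gT] r_pr; first by rewrite cardsT.
  exists x => //; rewrite inE -order_eq1 ox gtn_eqF ?prime_gt1 //=.
  apply: contraNN rs => /eqP genx; move: s_dv.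
  by rewrite -cardsT genx -/(order x) ox dvdn_prime2 // eq_sym.
have [x xS ox] := elt_of p q p_pr q_pr ltac:(by rewrite eq_sym) p_dv q_dv.
have [y yS oy] := elt_of q p q_pr p_pr qp q_dv p_dv.
have := tr_const x y xS yS.
rewrite (transmission_prime_order p_pr ox) (transmission_prime_order q_pr oy).
move/addnI => eq_part.
have {}eq_part : (#|gT|`_p^' = #|gT|`_q^')%N.
  by rewrite -[LHS]prednK ?part_gt0 // eq_part prednK ?part_gt0.
have : p \in primes (#|gT|`_q^')%N.
  by rewrite primes_part mem_filter mem_primes p_pr gT_gt0 p_dv !inE eq_sym qp.
by rewrite -eq_part primes_part mem_filter !inE eqxx.
Qed.
End CyclicPowerGraph.

(** * The bounds and their equality case *)

Theorem theorem3p1 (R : realType) (n : nat) (gT : finGroupType) :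
  (2 <= n)%N -> cyclic [set: gT] -> #|gT| = n ->
  let rho : R := distance_spectral_radius R (power_graph gT) in
  let l : R := (totient n)%:R + 1 in
  let bound (t : R) : R :=
    1 / 2 * ((t - 1)
      + Num.sqrt ((t - 2 * l + 1) ^+ 2 + 4 * l * (n%:R - l))) in
  let is_prime_power : Prop :=
    exists p m : nat, [/\ prime p, (0 < m)%N & n = (p ^ m)%N] in
  [/\ rho >= bound (tr_avg gT R),
      rho <= bound (tr_max gT)%:R,
      rho = bound (tr_avg gT R) <-> is_prime_power
    & rho = bound (tr_max gT)%:R <-> is_prime_power].
Proof.
move=> n_gt1 gT_cyclic cardT rho l bound is_prime_power.
pose S := nontrivial_nongenerators gT; pose tr x := transmission (power_graph gT) x.
pose d (x y : gT) : R := (gdist (power_graph gT) x y)%:R.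
have gT_gt1 : (1 < #|gT|)%N by rewrite cardT.
have dE := gdist_power_graph.
have d_sym x y : gdist (power_graph gT) x y = gdist (power_graph gT) y x.
  by rewrite !dE eq_sym power_graph_sym.
have dR_sym x y : d x y = d y x by rewrite /d d_sym.
have d_ge0 x y : 0 <= d x y by [].
have d_gt0 x y : x != y -> 0 < d x y.
  by move=> /negPf xy; rewrite /d dE xy ltr0n; case: ifP.
have d_diag x : d x x = 0 by rewrite /d dE eqxx.
have d_one x y : x \notin S -> x != y -> d x y = 1.
  by move=> xS xy; rewrite /d dE (negPf xy) power_graph_dominating.
have rhoP : top_eigenvalue d rho := distance_spectral_radiusP R 1%g d_sym.
have cardSC : #|~: S|%:R = l.
  by rewrite card_dominating // cardT -addn1 natrD.
have S_neqT : S != [set: gT].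
  by apply/eqP => /setP/(_ 1%g); rewrite !inE eqxx.
have boundE t : bound t = two_block_eigenvalue S t.
  by rewrite /two_block_eigenvalue cardSC cardT.
have trE x : \sum_y d x y = (tr x)%:R by rewrite /tr /transmission natr_sum.
have l_gt0 : 0 < l by rewrite ltr_wpDl.
have S0_l : S = set0 -> l = n%:R by rewrite -cardSC => ->; rewrite setC0 cardsT cardT.
have avg0 : S = set0 -> tr_avg gT R = n%:R - 1.
  by rewrite /tr_avg -/S => ->; rewrite cards0 eqxx cardT.
have max0 : S = set0 -> (tr_max gT)%:R = n%:R - 1 :> R.
  rewrite /tr_max -/S => ->; rewrite cards0 eqxx cardT.
  by rewrite -subn1 natrB // ltnW.
have sum_avg : \sum_(x in S) \sum_y d x y = tr_avg gT R * #|S|%:R.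
  rewrite (eq_bigr _ (fun x _ => trE x)).
  have [S0|S_neq0] := eqVneq S set0; first by rewrite S0 big_set0 cards0 mulr0.
  by rewrite /tr_avg cards_eq0 -/S (negPf S_neq0) divfK // pnatr_eq0 cards_eq0.
have le_max x : x \in S -> \sum_y d x y <= (tr_max gT)%:R.
  move=> xS; rewrite trE ler_nat /tr_max cards_eq0 -/S.
  by case: eqP xS => [->|_ xS]; [rewrite inE | exact: (@leq_bigmax_cond _ (mem S) tr)].
have ppow_const : is_prime_power -> {in S, forall x, tr x = n.-1}.
  case=> p [m [p_pr _ n_pm]] x _.
  by rewrite /tr (transmission_prime_power gT_cyclic _ p_pr (etrans cardT n_pm)) cardT.
have const_ppow (t : R) : [forall x in S, \sum_y d x y == t] -> is_prime_power.
  move=> /forall_inP const; rewrite /is_prime_power -cardT.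
  apply: constant_transmission_prime_power => // x y xS yS.
  apply/eqP; rewrite -(eqr_nat R) -/(tr x) -/(tr y) -!trE.
  by rewrite (eqP (const x xS)) (eqP (const y yS)).
(* For n prime S is empty and l = n, so the value n - 1 is below 2 l - 1. *)
have small (t : R) : (S = set0 -> t = n%:R - 1) -> S = set0 -> t < 2 * #|~: S|%:R - 1.
  by move=> t0 S0; rewrite cardSC t0 // -S0_l //; lra.
have [lower lower_eq] := two_block_lower dR_sym d_ge0 d_gt0 d_diag d_one rhoP
  S_neqT (small _ avg0) sum_avg.
have [upper upper_eq] := two_block_upper dR_sym d_ge0 d_gt0 d_diag d_one rhoP
  S_neqT (small _ max0) le_max.
rewrite !boundE; split=> //; split.
- by move=> eq_rho; apply: (const_ppow (tr_avg gT R)); rewrite -lower_eq eq_rho.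
- move/ppow_const => const; apply/esym/eqP; rewrite lower_eq.
  apply/forall_inP => x xS; rewrite trE const //.
  have S_neq0 : #|S|%:R != 0 :> R.
    by rewrite pnatr_eq0 cards_eq0; apply/set0Pn; exists x.
  apply/eqP/(mulIf S_neq0); rewrite -sum_avg mulr_natr -sumr_const.
  by apply: eq_bigr => y yS; rewrite trE const.
- by move=> eq_rho; apply: (const_ppow (tr_max gT)%:R); rewrite -upper_eq eq_rho.
move/ppow_const => const; apply/eqP; rewrite upper_eq.
apply/forall_inP => x xS; rewrite trE const // eqr_nat.
have nS0 : (#|S| == 0%N) = false.
  by rewrite cards_eq0; apply/negbTE/set0Pn; exists x.
rewrite /tr_max -/S nS0 eqn_leq; apply/andP; split.
  by rewrite -(const x xS); exact: (@leq_bigmax_cond _ (mem S) tr).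
by apply/bigmax_leqP => y yS; rewrite -/(tr y) const.
Qed.
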